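(* (i) Let $(P,\rhd,\lhd)$ be a Zinbiel-dendriform algebra and $(Q=\bigoplus_{i\in\mathbb Z}Q_i,\circ)$ a $\mathbb Z$-graded Leibniz algebra. Define a binary operation $\cdot$ on $P\otimes Q$ by $$(a\otimes x)\cdot(b\otimes y)=(a\rhd b)\otimes (x\circ y)-(b\lhd a)\otimes (y\circ x),\qquad a,b\in P,\ x,y\in Q.$$ Then $(P\otimes Q,\cdot)$ is a pre-Lie algebra. (ii) Moreover, let $P$ be a vector space with two bilinear operations $\rhd,\lhd$ and let $(Q,\circ)$ be the $\mathbb Z$-graded Leibniz algebra $Q=W\otimes\mathbb K[t,t^{-1}]=\bigoplus_{n\in\mathbb Z}W\otimes t^n$, $(x\otimes t^m)\circ(y\otimes t^n)=(x\circ y)\otimes t^{m+n}$, where $W$ has basis $\varepsilon_1,\varepsilon_2,\varepsilon_3,\varepsilon_4$ with nonzero products $\varepsilon_2\circ\varepsilon_1=\varepsilon_1$, $\varepsilon_2\circ\varepsilon_2=\varepsilon_1$, $\varepsilon_2\circ\varepsilon_3=-\varepsilon_3-\varepsilon_4$, $\varepsilon_3\circ\varepsilon_1=\varepsilon_4$, $\varepsilon_3\circ\varepsilon_2=\varepsilon_3+2\varepsilon_4$. Then $P\otimes Q$ with the operation $\cdot$ given by the same formula is a $\mathbb Z$-graded pre-Lie algebra if and only if $(P,\rhd,\lhd)$ is a Zinbiel-dendriform algebra.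
   Context: All vector spaces are over a field $\mathbb K$. Algebras are finite-dimensional except $\mathbb Z$-graded ones. A $\mathbb Z$-graded algebra is an algebra $Q=\bigoplus_iQ_i$ with $Q_i\circ Q_j\subseteq Q_{i+j}$; $P\otimes Q$ is graded by $P\otimes Q_i$. Pre-Lie algebra: $(x\cdot y)\cdot z-x\cdot(y\cdot z)=(y\cdot x)\cdot z-y\cdot(x\cdot z)$. Leibniz algebra: $x\circ(y\circ z)=(x\circ y)\circ z+y\circ(x\circ z)$. Zinbiel-dendriform algebra $(P,\rhd,\lhd)$: bilinear operations such that, with $x\ast y:=x\rhd y+x\lhd y$, for all $x,y,z$: $x\rhd(y\rhd z)=(x\ast y+y\ast x)\rhd z$ and $x\rhd(z\lhd y)=z\lhd(x\ast y)=(x\rhd z)\lhd y+(z\lhd x)\lhd y$. *)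

(* Defs.v *)
From HB Require Import structures.
From mathcomp Require Import all_boot all_order all_algebra.
From mathcomp Require Import finmap boolp.
From mathcomp.multinomials Require Import monalg.

Set Implicit Arguments.
Unset Strict Implicit.
Unset Printing Implicit Defensive.

Import GRing.Theory.
Local Open Scope ring_scope.
Local Open Scope quotient_scope.

Reserved Notation "a ⊗ x" (at level 40, left associativity).

Definition bilinear_op (K : fieldType) (U V W : lmodType K)
    (f : U -> V -> W) : Prop :=
  (forall u, linear (f u)) /\ (forall v, linear (f^~ v)).

(* The tensor product over K of two vector spaces of arbitrary dimension: the
   free vector space {malg K[P * Q]} on the set P * Q, with basis << (a, x) >>,
   divided by the subspace generated by the bilinearity relations. *)
Section TensorProduct.
Variables (K : fieldType) (P Q : lmodType K).

Inductive bilinear_relation : {malg K[(P * Q)%type]} -> Prop :=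
| Rel_zero : bilinear_relation 0
| Rel_comb c u v : bilinear_relation u -> bilinear_relation v ->
    bilinear_relation (c *: u + v)
| Rel_left c a b x : bilinear_relation
    (<< (c *: a + b, x) >> - c *: << (a, x) >> - << (b, x) >>)
| Rel_right c a x y : bilinear_relation
    (<< (a, c *: x + y) >> - c *: << (a, x) >> - << (a, y) >>).

Definition bilinear_relations : {pred {malg K[(P * Q)%type]}} :=
  fun u => `[< bilinear_relation u >].

Lemma bilinear_relations_submod : submod_closed bilinear_relations.
Proof.
split; first by apply/asboolP; exact: Rel_zero.
by move=> c u v /asboolP hu /asboolP hv; apply/asboolP; exact: Rel_comb.
Qed.

HB.instance Definition _ := GRing.isZmodClosed.Build _ bilinear_relations
  (GRing.submod_closedB bilinear_relations_submod).

Definition tensor : Type := Quotient.quot bilinear_relations.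

HB.instance Definition _ := GRing.Zmodule.on tensor.
HB.instance Definition _ := ZmodQuotient.on tensor.

Definition tensor_scale (c : K) (u : tensor) : tensor :=
  \pi_tensor (c *: repr u).

Lemma tensor_eqP (f g : {malg K[(P * Q)%type]}) :
  \pi_tensor f = \pi_tensor g <-> bilinear_relation (f - g).
Proof.
split=> [/eqP|h]; last apply/eqP.
  by rewrite eqquotE Quotient.equivE => /asboolP.
by rewrite eqquotE Quotient.equivE; apply/asboolP.
Qed.

Lemma relZ c f : bilinear_relation f -> bilinear_relation (c *: f).
Proof. by move=> h; rewrite -[_ *: _]addr0; apply: Rel_comb h Rel_zero. Qed.

Lemma pi_tensorZ c f : \pi_tensor (c *: f) = tensor_scale c (\pi_tensor f).
Proof.
apply/tensor_eqP; rewrite -scalerBr; apply: relZ.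
by apply/tensor_eqP; rewrite reprK.
Qed.

Lemma pi_tensorD f g :
  \pi_tensor (f + g) = \pi_tensor f + \pi_tensor g :> tensor.
Proof. exact: (raddfD (\pi_tensor : {malg K[(P * Q)%type]} -> tensor)). Qed.

Fact tensor_scaleA c d u :
  tensor_scale c (tensor_scale d u) = tensor_scale (c * d) u.
Proof.
by rewrite -[u]reprK -(pi_tensorZ d) -(pi_tensorZ c) -pi_tensorZ scalerA.
Qed.
Fact tensor_scale1 : left_id 1 tensor_scale.
Proof. by move=> u; rewrite -[u]reprK -pi_tensorZ scale1r. Qed.
Fact tensor_scaleDr : right_distributive tensor_scale +%R.
Proof.
move=> c u v; rewrite -[u]reprK -[v]reprK.
by rewrite -pi_tensorD -!pi_tensorZ scalerDr pi_tensorD.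
Qed.
Fact tensor_scaleDl u : {morph tensor_scale^~ u : c d / c + d}.
Proof.
by move=> c d; rewrite -[u]reprK -!pi_tensorZ scalerDl pi_tensorD.
Qed.

HB.instance Definition _ := GRing.Zmodule_isLmodule.Build K tensor
  tensor_scaleA tensor_scale1 tensor_scaleDr tensor_scaleDl.

Definition tens (a : P) (x : Q) : tensor := \pi_tensor << (a, x) >>.

(* The linear map induced on the tensor product by f; see [tensor_lift_linear]
   and [tensor_lift_tens] for f bilinear. *)
Definition free_lift (V : lmodType K) (f : P -> Q -> V)
    (u : {malg K[(P * Q)%type]}) : V :=
  \sum_(k <- msupp u) u@_k *: f k.1 k.2.

Definition tensor_lift (V : lmodType K) (f : P -> Q -> V) (u : tensor) : V :=
  free_lift f (repr u).

End TensorProduct.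

Notation "a ⊗ x" := (tens a x) : ring_scope.

Section TensorTheory.
Variables (K : fieldType) (P Q : lmodType K).
Implicit Types (V : lmodType K).

Lemma pi_tensor_linear : linear (\pi_(tensor P Q) : {malg K[(P * Q)%type]} -> _).
Proof. by move=> c u v; rewrite pi_tensorD pi_tensorZ. Qed.

Lemma tens_bilinear : bilinear_op (@tens K P Q).
Proof.
split=> [a c x y | x c a b]; rewrite /= /tens -pi_tensor_linear.
  by apply/tensor_eqP; rewrite opprD addrA; exact: Rel_right.
by apply/tensor_eqP; rewrite opprD addrA; exact: Rel_left.
Qed.

Lemma free_lift_sub V (f : P -> Q -> V) (d : {fset (P * Q)%type})
    (u : {malg K[(P * Q)%type]}) : (msupp u `<=` d)%fset ->
  free_lift f u = \sum_(k <- d) u@_k *: f k.1 k.2.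
Proof.
move=> le_d; rewrite /free_lift (big_fset_incl _ le_d) //= => k _ /mcoeff_outdom ->.
by rewrite scale0r.
Qed.

Lemma free_lift_linear V (f : P -> Q -> V) : linear (free_lift f).
Proof.
move=> c u v; set d := (msupp u `|` msupp v)%fset.
have lu : (msupp u `<=` d)%fset by apply: fsubsetUl.
have lv : (msupp v `<=` d)%fset by apply: fsubsetUr.
have luv : (msupp (c *: u + v) `<=` d)%fset.
  apply: fsubset_trans (msuppD_le _ _) _; apply: fsetSU; exact: msuppZ_le.
rewrite (free_lift_sub f lu) (free_lift_sub f lv) (free_lift_sub f luv).
rewrite scaler_sumr -big_split /=; apply: eq_bigr => k _.
by rewrite mcoeffD mcoeffZ scalerDl scalerA.
Qed.

Lemma free_liftU V (f : P -> Q -> V) a x : free_lift f << (a, x) >> = f a x.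
Proof. by rewrite (free_lift_sub f msuppU_le) big_seq_fset1 mcoeffUU scale1r. Qed.

Lemma free_lift_rel V (f : P -> Q -> V) (u : {malg K[(P * Q)%type]}) :
  bilinear_op f -> bilinear_relation u -> free_lift f u = 0.
Proof.
case=> fr fl.
have L := free_lift_linear f.
have L0 : free_lift f 0 = 0 by rewrite /free_lift msupp0 big_seq_fset0.
have LB w z : free_lift f (w - z) = free_lift f w - free_lift f z.
  by rewrite [w - z]addrC -(scaleN1r z) L scaleN1r addrC.
have LZ c w : free_lift f (c *: w) = c *: free_lift f w.
  by rewrite -[c *: w]addr0 L L0 addr0.
elim=> [|c w z _ hw _ hz|c a b x|c a x y] //.
- by rewrite L hw hz scaler0 addr0.
- by rewrite !LB LZ !free_liftU fl -addrA -opprD subrr.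
- by rewrite !LB LZ !free_liftU fr -addrA -opprD subrr.
Qed.

Lemma tensor_lift_pi V (f : P -> Q -> V) (u : {malg K[(P * Q)%type]}) :
  bilinear_op f -> tensor_lift f (\pi u) = free_lift f u.
Proof.
move=> hf; apply/eqP; rewrite -subr_eq0; apply/eqP.
rewrite addrC -scaleN1r -free_lift_linear scaleN1r addrC.
by apply: (free_lift_rel hf); apply/tensor_eqP; rewrite reprK.
Qed.

Lemma tensor_lift_linear V (f : P -> Q -> V) :
  bilinear_op f -> linear (tensor_lift f).
Proof.
move=> hf c u v; rewrite -[u]reprK -[v]reprK -pi_tensor_linear.
by rewrite !tensor_lift_pi // free_lift_linear.
Qed.

Lemma tensor_lift_tens V (f : P -> Q -> V) a x :
  bilinear_op f -> tensor_lift f (a ⊗ x) = f a x.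
Proof. by move=> hf; rewrite tensor_lift_pi // free_liftU. Qed.

Lemma tensor_span (u : tensor P Q) :
  exists s : seq (P * Q), u = \sum_(p <- s) p.1 ⊗ p.2.
Proof.
rewrite -[u]reprK; move: (repr u) => f.
exists [seq (f@_k *: k.1, k.2) | k <- msupp f].
rewrite big_map {1}[f]monalgE.
have [_ tl] := tens_bilinear.
have tl0 x : (0 : P) ⊗ x = 0 :> tensor P Q.
  have := tl x 0 0 0; rewrite !scale0r !add0r => h.
  by have := tl x (-1) 0 0; rewrite addr0 scaleN1r oppr0 h scaleN1r addNr.
rewrite (raddf_sum (\pi_(tensor P Q))); apply: eq_bigr => -[a x] _ /=.
have := tl x f@_(a, x) a 0; rewrite !addr0 tl0 addr0 => ->.
rewrite /tens -[RHS]pi_tensorZ; congr (\pi _); apply/malgP => k.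
by rewrite mcoeffZ !mcoeffU mulr_natr.
Qed.

End TensorTheory.

(* The binary operation on a tensor product prescribed on pure tensors by
   (a ⊗ x, b ⊗ y) |-> g a x b y; see [tensor_opE]. *)
Definition tensor_op (K : fieldType) (P Q V : lmodType K)
    (g : P -> Q -> P -> Q -> V) (u v : tensor P Q) : V :=
  tensor_lift (fun a x => tensor_lift (g a x) v) u.

Section TensorOp.
Variables (K : fieldType) (P Q V : lmodType K) (g : P -> Q -> P -> Q -> V).
Hypothesis g_right : forall a x, bilinear_op (g a x).
Hypothesis g_left : forall b y, bilinear_op (fun a x => g a x b y).

Lemma tensor_op_right_bilinear v :
  bilinear_op (fun a x => tensor_lift (g a x) v).
Proof.
have E a x : tensor_lift (g a x) v = free_lift (g a x) (repr v) by [].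
split=> [a c x y|x c a b]; rewrite !E /free_lift.
all: rewrite scaler_sumr -big_split /=; apply: eq_bigr => k _.
all: have [gr gl] := g_left k.1 k.2.
  by rewrite gr scalerDr !scalerA mulrC.
by rewrite gl scalerDr !scalerA mulrC.
Qed.

Lemma tensor_opE a x b y : tensor_op g (a ⊗ x) (b ⊗ y) = g a x b y.
Proof.
rewrite /tensor_op (tensor_lift_tens _ _ (tensor_op_right_bilinear _)).
exact: tensor_lift_tens.
Qed.

Lemma tensor_op_bilinear : bilinear_op (tensor_op g).
Proof.
split=> [u|v]; last exact/tensor_lift_linear/tensor_op_right_bilinear.
move=> c v w; rewrite /tensor_op /(tensor_lift (P := P)).
rewrite /free_lift scaler_sumr -big_split /=; apply: eq_bigr => k _.
by rewrite [X in _ *: X](tensor_lift_linear (g_right _ _)) scalerDr !scalerA mulrC.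
Qed.
End TensorOp.

Section Algebras.
Variables (K : fieldType) (A : lmodType K).

Definition pre_lie (op : A -> A -> A) : Prop :=
  bilinear_op op /\
  forall x y z, op (op x y) z - op x (op y z) = op (op y x) z - op y (op x z).

Definition leibniz (op : A -> A -> A) : Prop :=
  bilinear_op op /\
  forall x y z, op x (op y z) = op (op x y) z + op y (op x z).

Definition zinbiel_dendriform (rhd lhd : A -> A -> A) : Prop :=
  let ast x y := rhd x y + lhd x y in
  [/\ bilinear_op rhd, bilinear_op lhd,
      forall x y z, rhd x (rhd y z) = rhd (ast x y + ast y x) z,
      forall x y z, rhd x (lhd z y) = lhd z (ast x y) &
      forall x y z, lhd z (ast x y) = lhd (rhd x z) y + lhd (lhd z x) y].

Definition direct_sum_decomposition (G : int -> {pred A}) : Prop :=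
  [/\ forall i, submod_closed (G i),
      forall v, exists (s : seq int) (f : int -> A),
        [/\ uniq s, forall i, f i \in G i & v = \sum_(i <- s) f i] &
      forall (s : seq int) (f : int -> A),
        uniq s -> (forall i, f i \in G i) -> \sum_(i <- s) f i = 0 ->
        forall i, i \in s -> f i = 0].

Definition zgrading (G : int -> {pred A}) (op : A -> A -> A) : Prop :=
  direct_sum_decomposition G /\
  forall i j x y, x \in G i -> y \in G j -> op x y \in G (i + j).

Definition graded_leibniz (G : int -> {pred A}) (op : A -> A -> A) : Prop :=
  leibniz op /\ zgrading G op.

Definition graded_pre_lie (G : int -> {pred A}) (op : A -> A -> A) : Prop :=
  pre_lie op /\ zgrading G op.

End Algebras.

(* P ⊗ Q_i, as the subspace of P ⊗ Q spanned by the a ⊗ x with x in Q_i. *)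
Definition tensor_grading (K : fieldType) (P Q : lmodType K)
    (G : int -> {pred Q}) (i : int) : {pred tensor P Q} :=
  fun u => `[< exists2 s : seq (P * Q),
                 all (fun p => p.2 \in G i) s & u = \sum_(p <- s) p.1 ⊗ p.2 >].

Definition induced_op (K : fieldType) (P Q : lmodType K)
    (rhd lhd : P -> P -> P) (circ : Q -> Q -> Q) :
    tensor P Q -> tensor P Q -> tensor P Q :=
  tensor_op (fun a x b y => rhd a b ⊗ circ x y - lhd b a ⊗ circ y x).

Lemma bilinear_tens (K : fieldType) (U V P Q : lmodType K)
    (f : U -> P) (h : V -> Q) :
  linear f -> linear h -> bilinear_op (fun u v => f u ⊗ h v).
Proof.
have [tr tl] := tens_bilinear P Q.
by move=> lf lh; split=> [u c v w|v c u w]; rewrite ?lf ?lh ?tr ?tl.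
Qed.

Lemma bilinear_opB (K : fieldType) (U V W : lmodType K) (f h : U -> V -> W) :
  bilinear_op f -> bilinear_op h -> bilinear_op (fun u v => f u v - h u v).
Proof.
move=> [fr fl] [hr hl]; split=> [u c v w|v c u w].
  by rewrite fr hr scalerBr opprD addrACA.
by rewrite fl hl scalerBr opprD addrACA.
Qed.

Section InducedOp.
Variables (K : fieldType) (P Q : lmodType K).
Variables (rhd lhd : P -> P -> P) (circ : Q -> Q -> Q).
Hypotheses (rhdB : bilinear_op rhd) (lhdB : bilinear_op lhd).
Hypothesis circB : bilinear_op circ.

Let g a x b y := rhd a b ⊗ circ x y - lhd b a ⊗ circ y x.

Let g_right a x : bilinear_op (g a x).
Proof.
by apply: bilinear_opB; apply: bilinear_tens;
   (apply rhdB.1 || apply lhdB.2 || apply circB.1 || apply circB.2).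
Qed.

Let g_left b y : bilinear_op (fun a x => g a x b y).
Proof.
by apply: bilinear_opB; apply: bilinear_tens;
   (apply rhdB.2 || apply lhdB.1 || apply circB.2 || apply circB.1).
Qed.

Lemma induced_opE a b x y :
  induced_op rhd lhd circ (a ⊗ x) (b ⊗ y) =
  rhd a b ⊗ circ x y - lhd b a ⊗ circ y x.
Proof. exact (tensor_opE g_right g_left a x b y). Qed.

Lemma induced_op_bilinear : bilinear_op (induced_op rhd lhd circ).
Proof. exact (tensor_op_bilinear g_right g_left). Qed.
End InducedOp.

(* K[t, t^-1]: the free vector space on int, t^n being the basis vector << n >>.
   [monalg] only multiplies over monoids without nontrivial units, hence the
   product below. *)
Section Laurent.
Variable K : fieldType.

Definition laurent : lmodType K := {malg K[int]}.

Definition laurent_monomial (n : int) : {malg K[int]} := << n >>.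

Definition laurent_mul (p q : {malg K[int]}) : {malg K[int]} :=
  \sum_(m <- msupp p) \sum_(n <- msupp q) (p@_m * q@_n) *: laurent_monomial (m + n).

Lemma laurent_mul_sub (d e : {fset int}) (p q : {malg K[int]}) :
  (msupp p `<=` d)%fset -> (msupp q `<=` e)%fset ->
  laurent_mul p q =
  \sum_(m <- d) \sum_(n <- e) (p@_m * q@_n) *: laurent_monomial (m + n).
Proof.
move=> le_d le_e; rewrite /laurent_mul (big_fset_incl _ le_d) /=.
  apply: eq_bigr => m _; apply: big_fset_incl => // n _ /mcoeff_outdom ->.
  by rewrite mulr0 scale0r.
move=> m _ /mcoeff_outdom pm.
by rewrite big1 // => n _; rewrite pm mul0r scale0r.
Qed.

Lemma laurent_mulC (p q : {malg K[int]}) : laurent_mul p q = laurent_mul q p.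
Proof.
rewrite /laurent_mul exchange_big; apply: eq_bigr => n _.
by apply: eq_bigr => m _; rewrite mulrC addrC.
Qed.

Lemma laurent_mul_bilinear : bilinear_op laurent_mul.
Proof.
have H p : linear (laurent_mul^~ p).
  move=> c u v; set d := (msupp u `|` msupp v)%fset.
  have lu : (msupp u `<=` d)%fset by apply: fsubsetUl.
  have lv : (msupp v `<=` d)%fset by apply: fsubsetUr.
  have luv : (msupp (c *: u + v) `<=` d)%fset.
    apply: fsubset_trans (msuppD_le _ _) _; apply: fsetSU; exact: msuppZ_le.
  rewrite /= (laurent_mul_sub lu (fsubset_refl _)).
  rewrite (laurent_mul_sub lv (fsubset_refl _)).
  rewrite (laurent_mul_sub luv (fsubset_refl _)).
  rewrite scaler_sumr -big_split /=; apply: eq_bigr => m _.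
  rewrite scaler_sumr -big_split /=; apply: eq_bigr => n _.
  by rewrite mcoeffD mcoeffZ mulrDl scalerDl scalerA mulrA.
by split=> // p c u v; rewrite laurent_mulC H !(laurent_mulC _ p).
Qed.

Lemma laurent_mulE m n :
  laurent_mul (laurent_monomial m) (laurent_monomial n) =
  laurent_monomial (m + n).
Proof.
by rewrite (laurent_mul_sub msuppU_le msuppU_le) !big_seq_fset1 !mcoeffUU mulr1 scale1r.
Qed.

End Laurent.

(* W is K^4, and eps 1, ..., eps 4 its standard basis; its product is the
   bilinear extension of the table [W_table]. *)
Section AlgebraW.
Variable K : fieldType.

Definition W : lmodType K := 'rV[K]_4.

Definition eps (i : nat) : 'rV[K]_4 := delta_mx 0 (inord i.-1).

Definition W_table (i j : nat) : 'rV[K]_4 :=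
  match i, j with
  | 2%N, 1%N => eps 1
  | 2%N, 2%N => eps 1
  | 2%N, 3%N => - eps 3 - eps 4
  | 3%N, 1%N => eps 4
  | 3%N, 2%N => eps 3 + 2%:R *: eps 4
  | _, _ => 0
  end.

Definition W_mul : W -> W -> W := fun u v : 'rV[K]_4 =>
  \sum_(i < 4) \sum_(j < 4) (u 0 i * v 0 j) *: W_table i.+1 j.+1.

Lemma W_mulE (i j : 'I_4) : W_mul (eps i.+1) (eps j.+1) = W_table i.+1 j.+1.
Proof.
rewrite /W_mul (bigD1 i) //= (bigD1 j) //= !mxE !inord_val !eqxx mulr1 scale1r.
rewrite big1 ?addr0 => [|k nk]; last first.
  by rewrite !mxE inord_val (negPf nk) andbF mulr0 scale0r.
rewrite big1 ?addr0 // => k nk; rewrite big1 // => l _.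
by rewrite !mxE inord_val (negPf nk) andbF mul0r scale0r.
Qed.

Lemma W_mul_bilinear : bilinear_op W_mul.
Proof.
split=> [u c v w|w c u v]; rewrite /W_mul /= scaler_sumr -big_split.
all: apply: eq_bigr => i _; rewrite /= scaler_sumr -big_split.
all: apply: eq_bigr => j _ /=; rewrite !mxE.
  by rewrite mulrDr scalerDl scalerA mulrCA.
by rewrite mulrDl scalerDl scalerA mulrA.
Qed.

(* W ⊗ K[t, t^-1] *)
Definition WLaurent : lmodType K := tensor W (laurent K).

Definition WLaurent_mul : WLaurent -> WLaurent -> WLaurent :=
  tensor_op (fun w p w' q => W_mul w w' ⊗ laurent_mul p q).

(* W ⊗ t^n *)
Definition WLaurent_grading (n : int) : {pred WLaurent} :=
  fun u => `[< exists w : W, u = w ⊗ laurent_monomial K n >].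

Let g (w : W) (p : laurent K) (w' : W) (q : laurent K) : WLaurent :=
  W_mul w w' ⊗ laurent_mul p q.

Let g_right w p : bilinear_op (g w p).
Proof.
exact: (bilinear_tens (W_mul_bilinear.1 w) ((laurent_mul_bilinear K).1 p)).
Qed.

Let g_left w' q : bilinear_op (fun w p => g w p w' q).
Proof.
exact: (bilinear_tens (W_mul_bilinear.2 w') ((laurent_mul_bilinear K).2 q)).
Qed.

Lemma WLaurent_mul_bilinear : bilinear_op WLaurent_mul.
Proof. exact (tensor_op_bilinear g_right g_left). Qed.

Lemma WLaurent_mulE (x y : W) (m n : int) :
  WLaurent_mul (x ⊗ laurent_monomial K m) (y ⊗ laurent_monomial K n) =
  W_mul x y ⊗ laurent_monomial K (m + n).
Proof.
rewrite -laurent_mulE.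
exact (tensor_opE g_right g_left x (laurent_monomial K m) y (laurent_monomial K n)).
Qed.

End AlgebraW.

(* Main.v *)
From HB Require Import structures.
Require Import Defs.
From mathcomp Require Import all_boot all_order all_algebra.
From mathcomp Require Import boolp ring.
From mathcomp.multinomials Require Import monalg.

Set Implicit Arguments.
Unset Strict Implicit.
Unset Printing Implicit Defensive.

Import GRing.Theory.
Local Open Scope ring_scope.

(* A bilinear [op] is pre-Lie iff [op (op x y - op y x) z] equals
   [op x (op y z) - op y (op x z)], and a Leibniz product satisfies the same
   identity with [op x y] in place of the commutator.  On pure tensors of P ⊗ Q,
   the commutator of a ⊗ x and b ⊗ y is (a * b) ⊗ xy - (b * a) ⊗ yx, and the
   Leibniz identity reduces the pre-Lie one to right-normed products x(yz),
   whose coefficients vanish by the Zinbiel-dendriform axioms.  Conversely, at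
   (x, y, z) = (e2, e3, e1), (e2, e1, e3), (e2, e1, e2), in degree 0, all but two
   terms vanish and the three axioms come out as coefficients of e4, e4, e1. *)

(** * Linear and bilinear maps *)

Section Linear.
Variables (K : fieldType) (U V W : lmodType K).

Lemma linear_props (f : U -> V) : linear f ->
  [/\ f 0 = 0, {morph f : u / - u}, {morph f : u v / u + v},
      {morph f : u v / u - v} & scalable f].
Proof.
move=> lf.
pose F : {linear U -> V} := HB.pack f (GRing.isLinear.Build K U V *:%R f lf).
split; [exact: (linear0 F)|exact: (linearN F)|exact: (linearD F)
       |exact: (linearB F)|exact: (linearZ_LR F)].
Qed.

Lemma linear_big (f : U -> V) I (s : seq I) (F : I -> U) : linear f ->
  f (\sum_(i <- s) F i) = \sum_(i <- s) f (F i).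
Proof. by case/linear_props=> f0 _ fD _ _; exact: (big_morph f fD f0). Qed.

Lemma linear_compose (f : V -> W) (h : U -> V) :
  linear f -> linear h -> linear (fun u => f (h u)).
Proof. by move=> lf lh c u v; rewrite /= lh lf. Qed.

Lemma linear_sub (f h : U -> V) :
  linear f -> linear h -> linear (fun u => f u - h u).
Proof. by move=> lf lh c u v; rewrite /= lf lh scalerBr opprD addrACA. Qed.

End Linear.

Section Bilinear.
Variables (K : fieldType) (U V W : lmodType K) (f : U -> V -> W).
Hypothesis fB : bilinear_op f.

Let fl v := linear_props (fB.2 v).
Let fr u := linear_props (fB.1 u).

Lemma bilinear0l v : f 0 v = 0. Proof. by case: (fl v). Qed.
Lemma bilinear0r u : f u 0 = 0. Proof. by case: (fr u). Qed.
Lemma bilinearNl u v : f (- u) v = - f u v. Proof. by case: (fl v). Qed.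
Lemma bilinearNr u v : f u (- v) = - f u v. Proof. by case: (fr u). Qed.
Lemma bilinearDl u u' v : f (u + u') v = f u v + f u' v.
Proof. by case: (fl v). Qed.
Lemma bilinearBl u u' v : f (u - u') v = f u v - f u' v.
Proof. by case: (fl v). Qed.
Lemma bilinearBr u v v' : f u (v - v') = f u v - f u v'.
Proof. by case: (fr u). Qed.
Lemma bilinearDr u v v' : f u (v + v') = f u v + f u v'.
Proof. by case: (fr u). Qed.
Lemma bilinearZr c u v : f u (c *: v) = c *: f u v.
Proof. by case: (fr u) => _ _ _ _ ->. Qed.
Lemma bilinearZl c u v : f (c *: u) v = c *: f u v.
Proof. by case: (fl v) => _ _ _ _ ->. Qed.

End Bilinear.

(** * Spanning sets and direct sum decompositions *)

Section Sums.
Variables (K : fieldType) (A : lmodType K).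

(** The span of [S] without coefficients: the sets used below (pure tensors, homogeneous elements)
    are closed under scaling. *)
Definition sum_of (S : A -> Prop) (u : A) : Prop :=
  exists2 s : seq A, {in s, forall x, S x} & u = \sum_(x <- s) x.

Lemma sum_of_big (S : A -> Prop) I (s : seq I) (F : I -> A) :
  (forall i, sum_of S (F i)) -> sum_of S (\sum_(i <- s) F i).
Proof.
move=> SF; apply: (big_rec (sum_of S)) => [|i u _ [t St ->]].
  by exists [::] => //; rewrite big_nil.
have [r Sr ->] := SF i; exists (r ++ t); last by rewrite big_cat.
by move=> x; rewrite mem_cat => /orP[/Sr|/St].
Qed.

Lemma sum_of1 (S : A -> Prop) u : S u -> sum_of S u.
Proof.
by move=> Su; exists [:: u]; [move=> x; rewrite inE => /eqP-> | rewrite big_seq1].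
Qed.

Lemma linear_eq0 (B : lmodType K) (S : A -> Prop) (f : A -> B) :
  (forall u, sum_of S u) -> linear f -> (forall u, S u -> f u = 0) ->
  forall u, f u = 0.
Proof.
move=> spanS lf f0 u; have [s Ss ->] := spanS u.
by rewrite linear_big // big_seq big1 // => x /Ss/f0.
Qed.

Lemma trilinear_eq0 (B : lmodType K) (S : A -> Prop) (f : A -> A -> A -> B) :
  (forall u, sum_of S u) -> (forall y z, linear (fun x => f x y z)) ->
  (forall x z, linear (fun y => f x y z)) -> (forall x y, linear (f x y)) ->
  (forall x y z, S x -> S y -> S z -> f x y z = 0) ->
  forall x y z, f x y z = 0.
Proof.
move=> spanS l1 l2 l3 f0 x y z.
move: x; apply: (linear_eq0 spanS) => // x Sx.
move: y; apply: (linear_eq0 spanS) => // y Sy.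
by move: z; apply: (linear_eq0 spanS) => // z Sz; exact: f0.
Qed.

(** Existence comes from grouping homogeneous summands by degree. Uniqueness holds because [pr i]
    extracts the component of degree [i] from any sum. *)
Lemma direct_sum_of_projections (G : int -> {pred A}) (pr : int -> A -> A) :
  (forall i, submod_closed (G i)) ->
  (forall u, sum_of (fun x => exists i, x \in G i) u) ->
  (forall i, linear (pr i)) ->
  (forall i u, u \in G i -> pr i u = u) ->
  (forall i j u, j != i -> u \in G j -> pr i u = 0) ->
  direct_sum_decomposition G.
Proof.
move=> Gsub Gspan prL pr1 pr0; split=> // [v|s f s_uniq Gf sum0 i si].
  have [s Gs ->] := Gspan v.
  (* A degree has to be chosen, since 0 lies in every [G i]; the value [0] at non-homogeneous
     elements is a dummy. *)
  have [d dP] : {d : A -> int & forall x, (exists i, x \in G i) -> x \in G (d x)}.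
    apply: (@choice _ _ (fun x i => (exists j, x \in G j) -> x \in G i)) => x.
    by have [[i Gx]|nG] := pselect (exists i, x \in G i); [exists i|exists 0].
  exists (undup [seq d x | x <- s]), (fun i => \sum_(x <- s | d x == i) x).
  split=> [|i|]; first exact: undup_uniq.
    have [G0 GD] := Gsub i; rewrite big_seq_cond.
    elim/big_ind: _ => // [x y Gx Gy|x /andP[/Gs/dP Gx /eqP <-] //].
    by rewrite -[x]scale1r GD.
  (* After the exchange, each [x] is counted once, at the index [d x] of the duplicate-free list of
     degrees. *)
  rewrite (exchange_big_dep predT) //= big_seq [RHS]big_seq; apply: eq_bigr => x xs.
  rewrite -big_filter (eq_filter (a2 := pred1 (d x))) => [|i]; last exact: eq_sym.
  by rewrite filter_pred1_uniq ?undup_uniq ?mem_undup ?map_f // big_seq1.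
have: pr i (\sum_(j <- s) f j) = f i.
  rewrite linear_big // (bigD1_seq i) //= big1 ?addr0 ?pr1 // => j ji.
  exact: pr0 (Gf j).
by rewrite sum0 => <-; case: (linear_props (prL i)).
Qed.

End Sums.

(** * Commutator forms of the pre-Lie and Leibniz identities *)

Lemma subr_eq_swap (V : zmodType) (a b c d : V) :
  a - b = c - d <-> a - c = b - d.
Proof.
suff H (x y z t : V) : x - y = z - t -> x - z = y - t by split; apply: H.
by move/eqP; rewrite subr_eq => /eqP->; rewrite -[z - t + y]addrA [z + _]addrC addrK addrC.
Qed.

Section Identities.
Variables (K : fieldType) (A : lmodType K) (op : A -> A -> A).
Hypothesis opB : bilinear_op op.

Lemma pre_lie_commutator : pre_lie op <->
  forall x y z, op (op x y - op y x) z = op x (op y z) - op y (op x z).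
Proof.
split=> [[_ h] x y z|h].
  by rewrite (bilinearBl opB); apply/subr_eq_swap.
by split=> // x y z; apply/subr_eq_swap; rewrite -(bilinearBl opB).
Qed.

Lemma leibniz_commutator :
  (forall x y z, op (op x y) z = op x (op y z) - op y (op x z)) -> leibniz op.
Proof. by move=> h; split=> // x y z; rewrite h subrK. Qed.

(* The case [br] = commutator of [op] is the pre-Lie identity, and the case
   [br = op] the Leibniz identity. *)
Lemma representation_spanned (S : A -> Prop) (br : A -> A -> A) :
  (forall u, sum_of S u) -> bilinear_op br ->
  (forall x y z, S x -> S y -> S z ->
     op (br x y) z = op x (op y z) - op y (op x z)) ->
  forall x y z, op (br x y) z = op x (op y z) - op y (op x z).
Proof.
move=> spanS [brr brl] h x y z; apply/eqP; rewrite -subr_eq0; apply/eqP.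
move: x y z; have [opr opl] := opB.
apply: (trilinear_eq0 spanS) => [y z|x z|x y|x y z Sx Sy Sz]; last by rewrite h ?subrr.
all: apply: linear_sub; [|apply: linear_sub].
- exact: linear_compose (opl z) (brl y).
- exact: opl.
- exact: linear_compose (opr y) (opl z).
- exact: linear_compose (opl z) (brr x).
- exact: linear_compose (opr x) (opl z).
- exact: opl.
- exact: opr.
- exact: linear_compose (opr x) (opr y).
- exact: linear_compose (opr y) (opr x).
Qed.

Lemma pre_lie_spanned (S : A -> Prop) :
  (forall u, sum_of S u) ->
  (forall x y z, S x -> S y -> S z ->
     op (op x y - op y x) z = op x (op y z) - op y (op x z)) ->
  pre_lie op.
Proof.
move=> spanS h; apply/pre_lie_commutator.
apply: (representation_spanned (br := fun x y => op x y - op y x) spanS) => //.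
by apply: bilinear_opB => //; split; [exact: opB.2|exact: opB.1].
Qed.

End Identities.

(** * Calculation with pure tensors *)

Section Tens.
Variables (K : fieldType) (P Q : lmodType K).

Let tB := tens_bilinear P Q.

Lemma tensDl (a b : P) (x : Q) : (a + b) ⊗ x = a ⊗ x + b ⊗ x.
Proof. exact: bilinearDl tB _ _ _. Qed.
Lemma tensNl (a : P) (x : Q) : (- a) ⊗ x = - (a ⊗ x).
Proof. exact: bilinearNl tB _ _. Qed.
Lemma tensNr (a : P) (x : Q) : a ⊗ (- x) = - (a ⊗ x).
Proof. exact: bilinearNr tB _ _. Qed.
Lemma tensBr (a : P) (x y : Q) : a ⊗ (x - y) = a ⊗ x - a ⊗ y.
Proof. exact: bilinearBr tB _ _ _. Qed.
Lemma tensZl c (a : P) (x : Q) : (c *: a) ⊗ x = c *: (a ⊗ x).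
Proof. exact: bilinearZl tB _ _ _. Qed.
Lemma tens0l (x : Q) : (0 : P) ⊗ x = 0.
Proof. exact: bilinear0l tB _. Qed.
Lemma tens0r (a : P) : a ⊗ (0 : Q) = 0.
Proof. exact: bilinear0r tB _. Qed.

Lemma tensor_sum_of (u : tensor P Q) :
  sum_of (fun v => exists a x, v = a ⊗ x) u.
Proof.
have [s ->] := tensor_span u; apply: sum_of_big => -[a x].
by apply: sum_of1; exists a, x.
Qed.
End Tens.

(** * From Zinbiel-dendriform to pre-Lie *)

Section InducedOpIdentities.
Variables (K : fieldType) (P Q : lmodType K).
Variables (rhd lhd : P -> P -> P) (circ : Q -> Q -> Q).
Hypotheses (rhdB : bilinear_op rhd) (lhdB : bilinear_op lhd).
Hypothesis circL : leibniz circ.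

Local Notation op := (induced_op rhd lhd circ).
Local Notation "a ** b" := (rhd a b + lhd a b) (at level 40).

Let circB := circL.1.
Let opB : bilinear_op op := induced_op_bilinear rhdB lhdB circB.

Lemma leibniz_comp x y z : circ (circ x y) z = circ x (circ y z) - circ y (circ x z).
Proof. by rewrite [circ x (circ y z)]circL.2 addrK. Qed.

(** The expansion in [leibniz_comp] is antisymmetric in [x] and [y]. This merges pairs of terms in
    the two product formulas that follow. *)
Lemma leibniz_anticomm x y z : circ (circ y x) z = - circ (circ x y) z.
Proof. by rewrite !leibniz_comp opprB. Qed.

Lemma induced_commutator_op a b c x y z :
  op (op (a ⊗ x) (b ⊗ y) - op (b ⊗ y) (a ⊗ x)) (c ⊗ z) =
  rhd (a ** b + b ** a) c ⊗ circ (circ x y) z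
  - lhd c (a ** b) ⊗ circ z (circ x y) + lhd c (b ** a) ⊗ circ z (circ y x).
Proof.
have E := induced_opE rhdB lhdB circB.
have -> : op (a ⊗ x) (b ⊗ y) - op (b ⊗ y) (a ⊗ x) =
    (a ** b) ⊗ circ x y - (b ** a) ⊗ circ y x.
  by rewrite !E !tensDl opprB addrACA [in RHS]opprD [- _ - _ in RHS]addrC.
rewrite (bilinearBl opB) !E (leibniz_anticomm x y) tensNr.
rewrite [in RHS](bilinearDl rhdB (a ** b)) [in RHS]tensDl -opprD opprK addrA.
by congr (_ + _); exact: addrAC.
Qed.

(** The terms in [(yz)x] and [(zy)x] merge, and their joint coefficient is the right-hand side of
    the last Zinbiel-dendriform axiom. *)
Lemma induced_op_op a b c x y z :
  op (a ⊗ x) (op (b ⊗ y) (c ⊗ z)) =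
  rhd a (rhd b c) ⊗ circ x (circ y z) - rhd a (lhd c b) ⊗ circ x (circ z y)
  - (lhd (rhd b c) a + lhd (lhd c b) a) ⊗ circ (circ y z) x.
Proof.
have E := induced_opE rhdB lhdB circB.
rewrite (E b c) (bilinearBr opB) !E (leibniz_anticomm y z) tensNr tensDl.
by rewrite opprK !opprD addrACA.
Qed.

Lemma induced_op_pre_lie : zinbiel_dendriform rhd lhd -> pre_lie op.
Proof.
case=> _ _ zR zRL zL; apply: (pre_lie_spanned opB (@tensor_sum_of K P Q)).
move=> _ _ _ [a [x ->]] [b [y ->]] [c [z ->]].
(* The axioms reduce all coefficients to three: [rhd (a ** b + b ** a) c], [lhd c (a ** b)] and
   [lhd c (b ** a)]. *)
rewrite induced_commutator_op !induced_op_op -!zL !zR !zRL [b ** a + _]addrC.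
rewrite !leibniz_comp !tensBr.
(* Both sides equal [p - p' - q + r]; on the right, [k] and [l] each occur twice with opposite
   signs. *)
set p := _ ⊗ _; set p' := _ ⊗ _.
set k := _ ⊗ circ x (circ z y); set l := _ ⊗ circ y (circ z x).
set q := _ ⊗ circ z (circ x y); set r := _ ⊗ circ z (circ y x).
rewrite !opprB [p - k + _]addrACA [k - q + _]addrACA -[- k - l]opprD.
rewrite [RHS]addrA subrK.
by rewrite [- q - p']addrC addrACA -[LHS]addrA [- q + r]addrC.
Qed.
End InducedOpIdentities.

(** * The algebra [W] and its Laurent extension *)

Section AlgebraWTheory.
Variable K : fieldType.
Local Notation t := (laurent_monomial K).

Lemma sum_inord4 (V : zmodType) (F : 'I_4 -> V) :
  \sum_(i < 4) F i = F (inord 0) + F (inord 1) + F (inord 2) + F (inord 3).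
Proof.
rewrite !big_ord_recr big_ord0 /= add0r.
by congr (_ + _ + _ + _); congr F; apply: ord_inj; rewrite inordK.
Qed.

Lemma row4P (u v : 'rV[K]_4) :
  [/\ u 0 (inord 0) = v 0 (inord 0), u 0 (inord 1) = v 0 (inord 1),
      u 0 (inord 2) = v 0 (inord 2) & u 0 (inord 3) = v 0 (inord 3)] -> u = v.
Proof.
case=> h0 h1 h2 h3; apply/rowP => i; rewrite -[i]inord_val.
by case: i => -[|[|[|[|]]]].
Qed.

Lemma eps_mul i j : (i < 4)%N -> (j < 4)%N ->
  W_mul (eps K i.+1) (eps K j.+1) = W_table K i.+1 j.+1.
Proof. by move=> hi hj; exact: (W_mulE K (Ordinal hi) (Ordinal hj)). Qed.

(** Turns identities in [W] into polynomial identities for [ring]. The product of equations serves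
    as a single multi-rule for [rewrite]. *)
Lemma W_mul_coord (u v : 'rV[K]_4) : let w : 'rV[K]_4 := W_mul u v in
  ((w 0 (inord 0) = u 0 (inord 1) * (v 0 (inord 0) + v 0 (inord 1)))%R *
   (w 0 (inord 1) = 0)%R *
   (w 0 (inord 2) = u 0 (inord 2) * v 0 (inord 1)
                    - u 0 (inord 1) * v 0 (inord 2))%R *
   (w 0 (inord 3) = u 0 (inord 2) * (v 0 (inord 0) + 2%:R * v 0 (inord 1))
                    - u 0 (inord 1) * v 0 (inord 2))%R)%type.
Proof.
rewrite /= /W_mul !sum_inord4 !inordK //=.
split; [split; [split|]|].
all: rewrite !mxE -!val_eqE /= !inordK //=; ring.
Qed.

Lemma W_mul_leibniz (x y z : W K) :
  W_mul (W_mul x y) z = W_mul x (W_mul y z) - W_mul y (W_mul x z).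
Proof.
apply: row4P; split; rewrite !mxE !W_mul_coord; ring.
Qed.

Lemma WLaurent_sum_of (u : WLaurent K) :
  sum_of (fun v => exists (w : W K) n, v = w ⊗ t n) u.
Proof.
have [s ->] := tensor_span u; apply: sum_of_big => -[w p] /=.
have [tr tl] := tens_bilinear (W K) (laurent K).
rewrite [p]monalgE (linear_big _ _ (tr w)); apply: sum_of_big => n.
(* The coefficient of [t n] moves into the factor from [W]. *)
apply: sum_of1; exists (p@_n *: w), n.
have -> : << p@_n *g n >> = p@_n *: t n :> {malg K[int]}.
  by apply/malgP => k; rewrite mcoeffZ !mcoeffU mulr_natr.
by rewrite tensZl; case: (linear_props (tr w)) => _ _ _ _ ->.
Qed.

(* Abstract [op] and [tau]: with [WLaurent_mul] and [fun w n => w ⊗ t n] in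
   their place, the rewriting below diverges in unfolding the tensor product. *)
Lemma monomial_leibniz (A : lmodType K) (op : A -> A -> A) (tau : W K -> int -> A) :
  (forall x y m n, op (tau x m) (tau y n) = tau (W_mul x y) (m + n)) ->
  (forall x y n, tau (x - y) n = tau x n - tau y n) ->
  forall x y z l m n, op (op (tau x l) (tau y m)) (tau z n) =
    op (tau x l) (op (tau y m) (tau z n)) - op (tau y m) (op (tau x l) (tau z n)).
Proof.
move=> opE tauB x y z l m n.
by rewrite !opE W_mul_leibniz tauB -addrA (addrCA l).
Qed.

Lemma WLaurent_leibniz : leibniz (@WLaurent_mul K).
Proof.
have B := WLaurent_mul_bilinear K.
apply: leibniz_commutator => //; apply: (representation_spanned B WLaurent_sum_of B).
move=> _ _ _ [x [l ->]] [y [m ->]] [z [n ->]].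
apply: (monomial_leibniz (tau := fun w n => w ⊗ t n)).
  exact: WLaurent_mulE.
by move=> v w k; exact: (bilinearBl (tens_bilinear _ _)).
Qed.

(** The functional [coef], a coordinate on [W] times the coefficient of [t n], is 1 on
    [eps K i ⊗ t n]; applying it to the second factor, as [ev] does, recovers [a]. *)
Lemma tens_eps_inj (P : lmodType K) (a b : P) i n :
  a ⊗ (eps K i ⊗ t n : WLaurent K) = b ⊗ (eps K i ⊗ t n) -> a = b.
Proof.
pose coef (w : W K) (p : laurent K) : K^o :=
  (w : 'rV[K]_4) 0 (inord i.-1) * (p : {malg K[int]})@_n.
have coefB : bilinear_op coef.
  split=> [w c p q|p c w v]; rewrite /coef /=.
    by rewrite mcoeffD mcoeffZ mulrDr mulrCA.
  by rewrite !mxE mulrDl -mulrA.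
pose ev (c : P) (u : WLaurent K) := (tensor_lift coef u : K) *: c.
have evB : bilinear_op ev.
  split=> [c k u v|u k c d]; rewrite /ev /=.
    by rewrite (tensor_lift_linear coefB) scalerDl scalerA.
  by rewrite scalerDr !scalerA mulrC.
move=> /(congr1 (tensor_lift ev)); rewrite !(tensor_lift_tens _ _ evB) /ev.
rewrite (tensor_lift_tens _ _ coefB) /coef /laurent_monomial mcoeffUU.
by rewrite mxE !eqxx mulr1 !scale1r.
Qed.

End AlgebraWTheory.

(** * The grading of the tensor product *)

Section TensorGrading.
Variables (K : fieldType) (P Q : lmodType K) (G : int -> {pred Q}).

Lemma tensor_grading_tens i (a : P) x :
  x \in G i -> a ⊗ x \in tensor_grading (P := P) G i.
Proof. by move=> Gx; apply/asboolP; exists [:: (a, x)]; rewrite ?big_seq1 //= Gx. Qed.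

Lemma tensor_grading_submod i : submod_closed (tensor_grading (P := P) G i).
Proof.
split=> [|c u v /asboolP[s Gs ->] /asboolP[r Gr ->]]; apply/asboolP.
  by exists [::]; rewrite ?big_nil.
exists ([seq (c *: p.1, p.2) | p <- s] ++ r).
  by rewrite all_cat all_map /= Gr andbT; exact: Gs.
rewrite big_cat big_map scaler_sumr; congr (_ + _).
by apply: eq_bigr => p _; rewrite tensZl.
Qed.

Lemma tensor_gradingD i u v : u \in tensor_grading (P := P) G i ->
  v \in tensor_grading G i -> u + v \in tensor_grading G i.
Proof. by move=> Gu Gv; rewrite -[u]scale1r; apply: (tensor_grading_submod i).2. Qed.

Lemma tensor_grading_big i I (r : seq I) (p : pred I) (F : I -> tensor P Q) :
  (forall j, p j -> F j \in tensor_grading G i) ->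
  \sum_(j <- r | p j) F j \in tensor_grading G i.
Proof.
move=> GF; apply: (big_ind (fun u => u \in tensor_grading G i)) => //.
  exact: (tensor_grading_submod i).1.
by move=> u v; exact: tensor_gradingD.
Qed.

Lemma tensor_grading_op (rhd lhd : P -> P -> P) (circ : Q -> Q -> Q) :
  bilinear_op rhd -> bilinear_op lhd -> bilinear_op circ ->
  (forall i j x y, x \in G i -> y \in G j -> circ x y \in G (i + j)) ->
  forall i j u v, u \in tensor_grading G i -> v \in tensor_grading G j ->
    induced_op rhd lhd circ u v \in tensor_grading G (i + j).
Proof.
move=> rhdB lhdB circB Gcirc i j _ _ /asboolP[s Gs ->] /asboolP[r Gr ->].
have [opr opl] := induced_op_bilinear rhdB lhdB circB.
rewrite (linear_big _ _ (opl _)) big_seq; apply: tensor_grading_big => -[a x] /(allP Gs) Gx.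
rewrite (linear_big _ _ (opr _)) big_seq; apply: tensor_grading_big => -[b y] /(allP Gr) Gy.
rewrite induced_opE //= -tensNl; apply: tensor_gradingD; apply: tensor_grading_tens.
  exact: Gcirc.
by rewrite addrC; exact: Gcirc.
Qed.

(** The maps [id ⊗ pr i] are projections for the induced grading, so [direct_sum_of_projections]
    applies. *)
Lemma tensor_direct_sum (pr : int -> Q -> Q) :
  (forall x, sum_of (fun y => exists i, y \in G i) x) ->
  (forall i, linear (pr i)) ->
  (forall i x, x \in G i -> pr i x = x) ->
  (forall i j x, j != i -> x \in G j -> pr i x = 0) ->
  direct_sum_decomposition (tensor_grading (P := P) G).
Proof.
move=> Gspan prL pr1 pr0.
have [tr tl] := tens_bilinear P Q.
have tprB i : bilinear_op (fun (a : P) x => a ⊗ pr i x).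
  by apply: (bilinear_tens (f := id)).
have prE i s (F : P * Q -> Q) : {in s, forall p, pr i p.2 = F p} ->
    tensor_lift (fun a x => a ⊗ pr i x) (\sum_(p <- s) p.1 ⊗ p.2) =
    \sum_(p <- s) p.1 ⊗ F p.
  move=> sF; rewrite (linear_big _ _ (tensor_lift_linear (tprB i))).
  rewrite big_seq [RHS]big_seq; apply: eq_bigr => p /sF <-.
  exact: (tensor_lift_tens _ _ (tprB i)).
apply: (direct_sum_of_projections (pr := fun i => tensor_lift (fun a x => a ⊗ pr i x))).
- exact: tensor_grading_submod.
- move=> u; have [s ->] := tensor_span u; apply: sum_of_big => -[a x] /=.
  (* [sum_of_big] quantifies over all indices, so those outside [r] are given the summand 0, an
     empty sum. *)
  have [r Gr ->] := Gspan x; rewrite (linear_big _ _ (tr a)) big_seq big_mkcond /=.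
  apply: sum_of_big => y; case: ifP => [/Gr[i Gy]|_].
    by apply: sum_of1; exists i; exact: tensor_grading_tens.
  by exists [::] => //; rewrite big_nil.
- by move=> i; exact: tensor_lift_linear.
- move=> i _ /asboolP[s /allP Gs ->]; rewrite (prE _ _ snd) // => p /Gs.
  exact: pr1.
- move=> i j _ ji /asboolP[s /allP Gs ->]; rewrite (prE _ _ (fun=> 0)) => [|p /Gs].
    by rewrite big1 // => p _; rewrite tens0r.
  exact: pr0.
Qed.

End TensorGrading.

Lemma WLaurent_tensor_zgrading (K : fieldType) (P : lmodType K)
    (rhd lhd : P -> P -> P) : bilinear_op rhd -> bilinear_op lhd ->
  zgrading (tensor_grading (P := P) (@WLaurent_grading K))
    (induced_op rhd lhd (@WLaurent_mul K)).
Proof.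
move=> rhdB lhdB; split; last first.
  apply: (tensor_grading_op rhdB lhdB (WLaurent_mul_bilinear K)).
  move=> i j _ _ /asboolP[w ->] /asboolP[v ->]; apply/asboolP.
  by exists (W_mul w v); exact: WLaurent_mulE.
(* Lifted to the tensor product, [comp n] is the projection onto [W ⊗ t^n]. *)
pose comp n (w : W K) (p : laurent K) : WLaurent K :=
  ((p : {malg K[int]})@_n *: w) ⊗ laurent_monomial K n.
have compB n : bilinear_op (comp n).
  split=> [w c p q|p c w v]; rewrite /comp /=.
    by rewrite mcoeffD mcoeffZ scalerDl tensDl -scalerA tensZl.
  by rewrite scalerDr tensDl !scalerA mulrC -scalerA tensZl.
have compE n m w : tensor_lift (comp n) (w ⊗ laurent_monomial K m) =
    ((m == n)%:R *: w) ⊗ laurent_monomial K n.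
  by rewrite (tensor_lift_tens _ _ (compB n)) /comp mcoeffU.
apply: (@tensor_direct_sum _ _ _ _ (fun n => tensor_lift (comp n))).
- move=> u; have [s Ss ->] := WLaurent_sum_of u; exists s => // v /Ss[w [n ->]].
  by exists n; apply/asboolP; exists w.
- by move=> n; exact: tensor_lift_linear.
- by move=> n _ /asboolP[w ->]; rewrite compE eqxx scale1r.
- by move=> n m _ mn /asboolP[w ->]; rewrite compE (negPf mn) scale0r tens0l.
Qed.

(** * From pre-Lie to Zinbiel-dendriform, through a copy [tau] of [W] inside [Q] *)

Section Converse.
Variables (K : fieldType) (P Q : lmodType K).
Variables (rhd lhd : P -> P -> P) (circ : Q -> Q -> Q) (tau : W K -> Q).
Hypotheses (rhdB : bilinear_op rhd) (lhdB : bilinear_op lhd).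
Hypotheses (circL : leibniz circ) (tauL : linear tau).
Hypothesis tauM : forall x y, circ (tau x) (tau y) = tau (W_mul x y).
Hypothesis tau_inj : forall (a b : P) i, a ⊗ tau (eps K i) = b ⊗ tau (eps K i) -> a = b.

Lemma zinbiel_dendriform_of_pre_lie :
  pre_lie (induced_op rhd lhd circ) -> zinbiel_dendriform rhd lhd.
Proof.
move=> pL.
have [t0 tN _ _ _] := linear_props tauL.
have W0 := W_mul_bilinear K.
have Wlin := (bilinearBl W0, bilinearNl W0, bilinear0l W0, bilinear0r W0,
  bilinearBr W0, bilinearNr W0, bilinearDr W0, bilinearZr W0).
have key a b c x y z := (pre_lie_commutator (induced_op_bilinear rhdB lhdB circL.1)).1
  pL (a ⊗ tau x) (b ⊗ tau y) (c ⊗ tau z).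
have {}key a b c x y z := etrans (esym (induced_commutator_op rhdB lhdB circL
  a b c (tau x) (tau y) (tau z))) (key a b c x y z).
have F2 := induced_op_op rhdB lhdB circL.
(* The surviving products are [(xy)z = -e4] and [y(xz) = e4]. *)
have zR a b c : rhd b (rhd a c) = rhd (rhd a b + lhd a b + (rhd b a + lhd b a)) c.
  apply: (@tau_inj _ _ 4); have := key a b c (eps K 2) (eps K 3) (eps K 1).
  rewrite !F2 !tauM !eps_mul //= !Wlin !eps_mul //=
    !(t0, tN, tens0r, tensNr, subr0, sub0r, add0r, addr0, oppr0, opprK, scaler0).
  by move/oppr_inj.
(* The surviving products are [z(xy) = e4] and [(xz)y = -e4]. *)
have zL a b c : lhd c (rhd a b + lhd a b) = lhd (rhd a c) b + lhd (lhd c a) b.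
  apply: (@tau_inj _ _ 4); have := key a b c (eps K 2) (eps K 1) (eps K 3).
  rewrite !F2 !tauM !eps_mul //= !Wlin !eps_mul //=
    !(t0, tN, tens0r, tensNr, subr0, sub0r, add0r, addr0, oppr0, opprK, scaler0).
  by move/oppr_inj.
(* The surviving products are [z(xy) = e1] and [x(zy) = e1]. *)
have zRL a b c : rhd a (lhd c b) = lhd c (rhd a b + lhd a b).
  apply: (@tau_inj _ _ 1); have := key a b c (eps K 2) (eps K 1) (eps K 2).
  rewrite !F2 !tauM !eps_mul //= !Wlin ?eps_mul //=
    !(t0, tN, tens0r, tensNr, subr0, sub0r, add0r, addr0, oppr0, opprK, scaler0).
  by move/oppr_inj.
split=> [||x y z||]; [by []|by []| |exact: zRL|exact: zL].
by rewrite zR [rhd y x + _ + _]addrC.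
Qed.
End Converse.

Theorem proposition3p15 (K : fieldType) :
  (forall (P : vectType K) (rhd lhd : P -> P -> P)
          (Q : lmodType K) (G : int -> {pred Q}) (circ : Q -> Q -> Q),
     zinbiel_dendriform rhd lhd ->
     graded_leibniz G circ ->
     pre_lie (induced_op rhd lhd circ))
  /\
  (forall (P : lmodType K) (rhd lhd : P -> P -> P),
     bilinear_op rhd -> bilinear_op lhd ->
     graded_pre_lie (tensor_grading (P := P) (@WLaurent_grading K))
                    (induced_op rhd lhd (@WLaurent_mul K))
     <-> zinbiel_dendriform rhd lhd).
Proof.
split=> [P rhd lhd Q G circ zd [circL _]|P rhd lhd rhdB lhdB].
  by have [rhdB lhdB _ _ _] := zd; exact: induced_op_pre_lie.
split=> [[pL _]|zd]; last first.
  split; last exact: WLaurent_tensor_zgrading.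
  exact: induced_op_pre_lie rhdB lhdB (WLaurent_leibniz K) zd.
(* Degree 0 makes [tau] multiplicative, because [0 + 0 = 0]. *)
apply: (zinbiel_dendriform_of_pre_lie (tau := fun w => w ⊗ laurent_monomial K 0)
  rhdB lhdB (WLaurent_leibniz K) _ _ _ pL).
- exact: (tens_bilinear _ _).2.
- by move=> x y; rewrite -[in RHS](addr0 0); exact: WLaurent_mulE.
- by move=> a b i; exact: tens_eps_inj.
Qed.
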